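(* Let $S_1,S_2,\dots$ be iid unit-rate exponential random variables, $\zeta\in(0,1)$, $\theta\in\mathbb{R}$, and $V_n=\theta\sum_{k=1}^n\zeta^kS_k$. For every positive integer $m$, the $m$th moment of $V_n$ is given by $$\mathbb{E}[(V_n)^m]=\theta^m\cdot m!\sum_{k=m}^{nm}\pi_n^{(k,m)}\zeta^k,$$ where $\pi_n^{(k,m)}$ is the number of partitions of $k$ into $m$ positive parts, each of size less than or equal to $n$. *)

(* Defs.v *)
From HB Require Import structures.
From mathcomp Require Import all_boot all_order all_algebra finmap.
From mathcomp Require Import all_classical all_reals all_analysis.

Set Implicit Arguments.
Unset Strict Implicit.
Unset Printing Implicit Defensive.

Import Order.TTheory GRing.Theory Num.Theory.

Local Open Scope classical_set_scope.
Local Open Scope ring_scope.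

Section random_variables.
Context (d : measure_display) (T : measurableType d) (R : realType).
Variable P : probability T R.

Definition mutually_independent (I : choiceType) (D : set I)
    (X : I -> {RV P >-> R}) : Prop :=
  forall (J : {fset I}) (B : I -> set R),
    [set` J] `<=` D ->
    (forall i, i \in J -> measurable (B i)) ->
    P (\bigcap_(i in [set` J]) (X i @^-1` B i)) =
    (\prod_(i <- J) P (X i @^-1` B i))%E.

(* Only measurable sets are compared: [distribution] and [exponential_prob]
   also return values, without meaning, on non-measurable sets. *)
Definition exponentially_distributed (rate : R) (X : {RV P >-> R}) : Prop :=
  forall A : set R, measurable A -> distribution P X A = exponential_prob rate A.

(* The sequence is S_1, S_2, ...: nothing is assumed about [S 0]. *)
Definition iid_unit_exponential (S : nat -> {RV P >-> R}) : Prop :=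
  mutually_independent [set k | (0 < k)%N] S /\
  forall k, (0 < k)%N -> exponentially_distributed 1 (S k).

Definition weighted_sum (theta zeta : R) (S : nat -> {RV P >-> R}) (n : nat) :
    T -> R :=
  fun w => theta * \sum_(1 <= k < n.+1) zeta ^+ k * S k w.

End random_variables.

(* A partition is represented by its parts listed in nonincreasing order. *)
Definition is_partition (k : nat) (s : seq nat) : bool :=
  [&& sorted geq s, all (leq 1) s & sumn s == k].

(* The type ['I_n.+1] of the entries bounds the parts by [n]. *)
Definition num_partitions (n k m : nat) : nat :=
  #|[set t : m.-tuple 'I_n.+1 | is_partition k [seq val i | i <- t]]%SET|.

(* Main.v *)
Require Import Defs.
From mathcomp Require Import all_boot all_order all_algebra finmap.
From mathcomp Require Import all_classical all_reals all_analysis.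
From mathcomp Require Import measurable_realfun ring.
Set Implicit Arguments.
Unset Strict Implicit.
Import Order.TTheory GRing.Theory Num.Theory.
Import numFieldNormedType.Exports.
Local Open Scope classical_set_scope.
Local Open Scope ring_scope.

(**
Let [W_n = sum_(1 <= k <= n) a_k S_k] with nonnegative weights [a_k].  Up to the
factor [theta ^ m], the theorem is the case [a_k = zeta ^ k] of the identity
[E[W_n ^ m] = m! h_m(a_1, ..., a_n)], where [h_m] is the complete homogeneous
symmetric polynomial.  Indeed, since the [S_k] are independent and
[E[S_k ^ j] = j!], the factorials cancel the denominators of the multinomial
expansion of [W_n ^ m], and each monomial of degree [m] in the weights is left
with the same coefficient [m!].  The monomials
are indexed by the multisets of [m] indices in [1, n], that is, by the
partitions into [m] parts at most [n], and for [a_k = zeta ^ k] a partition of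
the number [l] contributes [zeta ^ l].

The expansion is carried out one variable at a time, by induction on [n].  With
[X = S_(n+1)], the binomial theorem expresses the [m]-th moment of
[W_n + a_(n+1) X] through the mixed moments [E[X ^ i W_n ^ j]], and
[complete_homogeneousS] is the matching recursion for [h_m].  To split a mixed
moment, the induction hypothesis has to know more than the moments of [W_n]:
[absolute_moment_cylinder] integrates [W_n ^ j] over any event [G] that bears on
finitely many of the variables of index larger than [n], and states that the
result is [E[W_n ^ j] P(G)].  Applied to the events [G /\ {X in A}], it says
that the measure [A |-> int_(G /\ {X in A}) W_n ^ j dP] is proportional to the
law of [X], and [ge0_integral_density] turns this equality of measures into the
equality of the integrals of [x ^ i].  The same density lemma, applied to the
identity map, rewrites integrals for the law of [X] as integrals against the
exponential density.

A variable with exponential law is nonnegative only almost surely.  The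
induction is therefore carried out with [|S_k|], so that all the integrands are
nonnegative and no integrability condition arises before the end; the signs of
[S_k] and of [theta] are restored in [exponential_sum_moment].
*)

(** * Partitions with bounded parts and complete homogeneous polynomials *)

(** The partitions into [m] parts at most [n].  Those whose largest part is
    [n.+1] are the [n.+1 :: s] with [s] a partition into one part less, still
    bounded by [n.+1]: this is the Pascal-type recursion of the complete
    homogeneous polynomials. *)
Fixpoint partitions_le (n : nat) : nat -> seq (seq nat) :=
  if n is n'.+1 then
    fix partitions_leS m := if m is m'.+1 then
      partitions_le n' m ++ [seq n :: s | s <- partitions_leS m'] else [:: [::]]
  else fun m => if m is 0 then [:: [::]] else [::].

Lemma partitions_le0 n : partitions_le n 0 = [:: [::]].
Proof. by case: n. Qed.

Lemma partitions_leSS n m : partitions_le n.+1 m.+1 =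
  partitions_le n m.+1 ++ [seq n.+1 :: s | s <- partitions_le n.+1 m].
Proof. by []. Qed.

Lemma mem_partitions_le n m s : (s \in partitions_le n m) =
  [&& size s == m, sorted geq s, all (leq 1) s & all (geq n) s].
Proof.
elim: n m s => [|n IHn] m s.
  case: m => [|m]; first by rewrite mem_seq1; case: s => [|x s].
  by rewrite in_nil; case: s => [|[|x] s]; rewrite //= ?andbF.
elim: m s => [|m IHm] [|x s]; rewrite ?partitions_le0 //.
  by rewrite partitions_leSS mem_cat IHn; apply/negbTE/mapP => -[].
have -> : (x :: s \in partitions_le n.+1 m.+1) =
    (x :: s \in partitions_le n m.+1) ||
    (x == n.+1) && (s \in partitions_le n.+1 m).
  rewrite partitions_leSS mem_cat; congr (_ || _).
  apply/mapP/andP => [[t st [-> ->]] //|[/eqP-> sP]]; by exists s.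
(* Both sides are now compared factor by factor; a nonincreasing sequence is
   bounded by its head, so the bound on [s] follows from the bound on [x]. *)
rewrite IHn IHm /= eqSS (path_sortedE (rev_trans leq_trans)).
case: (size s == m) => /=; last by rewrite andbF.
case: (sorted geq s) => /=; last by rewrite !andbF.
case: (all (leq 1) s) => /=; last by rewrite !andbF.
rewrite !andbT.
have -> : (x <= n.+1)%N = (x <= n)%N || (x == n.+1).
  by rewrite leq_eqVlt ltnS orbC.
have [->|xn] := eqVneq x n.+1.
  by rewrite ltnn /= andbF andbb.
rewrite /= !orbF.
have [xn'|] := leqP x n; last by rewrite /= !andbF.
case xs: (all (geq x) s) => //=.
suff [-> ->] : all (geq n) s /\ all (geq n.+1) s by [].
by split; apply: sub_all xs => y /= /leq_trans; apply=> //; exact: leqW.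
Qed.

Lemma partitions_le_uniq n m : uniq (partitions_le n m).
Proof.
elim: n m => [|n IHn] m; first by case: m.
elim: m => [|m IHm]; first by rewrite partitions_le0.
rewrite partitions_leSS cat_uniq IHn map_inj_uniq ?IHm ?andbT => [|? ? []] //.
apply/hasPn => _ /mapP[s _ ->]; rewrite mem_partitions_le.
by rewrite /= ltnn !andbF.
Qed.

Lemma num_partitionsE n k m :
  num_partitions n k m = count (fun s => sumn s == k) (partitions_le n m).
Proof.
rewrite /num_partitions cardE -size_filter.
pose f (t : m.-tuple 'I_n.+1) := [seq val i | i <- t].
have f_inj : injective f by move=> s t /(inj_map val_inj) /val_inj.
rewrite -(size_map f); apply/perm_size/uniq_perm.
- by rewrite (map_inj_uniq f_inj) enum_uniq.
- by rewrite filter_uniq ?partitions_le_uniq.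
move=> s; rewrite mem_filter mem_partitions_le; apply/mapP/idP.
  move=> [t]; rewrite mem_enum inE /is_partition => /and3P[st pt kt] ->.
  rewrite kt st pt size_map size_tuple eqxx /=.
  by apply/allP => _ /mapP[i _ ->]; rewrite /= -ltnS.
move=> /and5P[ks ms ss ps ns].
have ts : size [seq inord i : 'I_n.+1 | i <- s] == m by rewrite size_map.
have fs : f (Tuple ts) = s.
  rewrite /f /= -map_comp; apply: map_id_in => i si /=.
  by rewrite inordK // ltnS; exact: (allP ns).
by exists (Tuple ts) => //; rewrite mem_enum inE -/(f _) fs /is_partition ss ps.
Qed.

Lemma sumn_partitions_le n m s : s \in partitions_le n m ->
  (m <= sumn s <= n * m)%N.
Proof.
rewrite mem_partitions_le => /and4P[/eqP<- _ {m}].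
elim: s => [|x s IHs] //= /andP[x0 s0] /andP[xn sn].
have /andP[ms sm] := IHs s0 sn.
by rewrite mulnS leq_add // (leq_trans _ (leq_add x0 ms)).
Qed.

(** The polynomial [h_m(a_1, ..., a_n)]: each monomial is listed once, as the
    nonincreasing sequence of its indices. *)
Definition complete_homogeneous (R : comNzRingType) (a : nat -> R) n m : R :=
  \sum_(s <- partitions_le n m) \prod_(i <- s) a i.

Lemma complete_homogeneous0r (R : comNzRingType) (a : nat -> R) n :
  complete_homogeneous a n 0 = 1.
Proof. by rewrite /complete_homogeneous partitions_le0 big_seq1 big_nil. Qed.

Lemma complete_homogeneousSS (R : comNzRingType) (a : nat -> R) n m :
  complete_homogeneous a n.+1 m.+1 =
  complete_homogeneous a n m.+1 + a n.+1 * complete_homogeneous a n.+1 m.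
Proof.
rewrite /complete_homogeneous partitions_leSS big_cat big_map mulr_sumr.
by congr (_ + _); apply: eq_bigr => s _; rewrite big_cons.
Qed.

(** Sorting the monomials by the exponent [j] of the last variable; in contrast
    with [complete_homogeneousSS], only [n] variables occur on the right. *)
Lemma complete_homogeneousS (R : comNzRingType) (a : nat -> R) n m :
  complete_homogeneous a n.+1 m =
  \sum_(j < m.+1) a n.+1 ^+ j * complete_homogeneous a n (m - j).
Proof.
elim: m => [|m IHm].
  by rewrite big_ord1 !complete_homogeneous0r mulr1.
rewrite complete_homogeneousSS IHm mulr_sumr [RHS]big_ord_recl mul1r.
by congr (_ + _); apply: eq_bigr => j _; rewrite mulrA -exprS.
Qed.

Lemma complete_homogeneous_expr (R : comNzRingType) (z : R) n m :
  complete_homogeneous (fun i => z ^+ i) n m =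
  \sum_(m <= k < (n * m).+1) (num_partitions n k m)%:R * z ^+ k.
Proof.
have -> : complete_homogeneous (fun i => z ^+ i) n m =
    \sum_(s <- partitions_le n m) \sum_(m <= k < (n * m).+1)
      (sumn s == k)%:R * z ^+ k.
  rewrite /complete_homogeneous big_seq [RHS]big_seq.
  apply: eq_bigr => s /sumn_partitions_le /andP[ms sn].
  have -> : \prod_(i <- s) z ^+ i = z ^+ sumn s.
    by rewrite sumnE expr_sum.
  rewrite (bigD1_seq (sumn s)) ?mem_index_iota ?iota_uniq ?ms ?ltnS //=.
  rewrite eqxx mul1r big1 ?addr0 // => k /negbTE ks.
  by rewrite eq_sym ks mul0r.
rewrite exchange_big; apply: eq_bigr => k _.
rewrite -mulr_suml num_partitionsE -sum1_count natr_sum [in RHS]big_mkcond.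
by congr (_ * _); apply: eq_bigr => s _; case: ifP.
Qed.

Lemma complete_homogeneous_ge0 (R : numDomainType) (a : nat -> R) n m :
  (forall k, 0 <= a k) -> 0 <= complete_homogeneous a n m.
Proof. by move=> a0; apply: sumr_ge0 => s _; exact: prodr_ge0. Qed.

(** * Integration against a measure given by a density *)

Section density.
Local Open Scope ereal_scope.
Import HBNNSimple.
Context d d' (T : measurableType d) (T' : measurableType d') (R : realType).
Variables (mu : {measure set T -> \bar R}) (nu : {measure set T' -> \bar R}).
Variables (D : set T) (X : T -> T') (Y : T -> R).
Hypotheses (mD : measurable D) (mX : measurable_fun setT X)
  (mY : measurable_fun setT Y) (Y0 : forall x, (0 <= Y x)%R).
Hypothesis nuE : forall A, measurable A ->
  \int[mu]_(x in D `&` X @^-1` A) (Y x)%:E = nu A.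

(** The hypothesis [nuE] is the case where [f] is an indicator function; it
    extends to simple functions by linearity and to nonnegative measurable
    functions by monotone convergence. *)
Lemma ge0_integral_density (f : T' -> \bar R) :
  measurable_fun setT f -> (forall y, 0 <= f y) ->
  \int[mu]_(x in D) (f (X x) * (Y x)%:E) = \int[nu]_y f y.
Proof.
move=> mf f0; pose h := nnsfun_approx measurableT mf.
have h_cvg y : (h n y)%:E @[n --> \oo] --> f y.
  by apply: cvg_nnsfun_approx.
have h_nd y : {homo (fun n => h n y) : m n / (m <= n)%N >-> (m <= n)%R}.
  by move=> m n mn; exact/lefP/nd_nnsfun_approx.
have mhX n : measurable_fun D (fun x => (h n (X x))%:E).
  by apply/measurable_EFinP/measurable_funTS/measurableT_comp.
have mYE : measurable_fun D (fun x => (Y x)%:E).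
  by apply/measurable_EFinP/measurable_funTS.
have -> : \int[nu]_y f y = limn (fun n => \int[nu]_y (h n y)%:E).
  rewrite -monotone_convergence //.
  - by apply: eq_integral => y _; apply/esym/cvg_lim => //; exact: h_cvg.
  - by move=> n; exact/measurable_EFinP.
  - by move=> n y _; rewrite lee_fin.
  - by move=> y _ m n mn; rewrite lee_fin; exact: h_nd.
have -> : \int[mu]_(x in D) (f (X x) * (Y x)%:E) =
    limn (fun n => \int[mu]_(x in D) ((h n (X x))%:E * (Y x)%:E)).
  rewrite -monotone_convergence //.
  - apply: eq_integral => x _; apply/esym/cvg_lim => //.
    by apply: cvgeZr => //; exact: h_cvg.
  - by move=> n; exact: emeasurable_funM.
  - by move=> n x _; rewrite mule_ge0 ?lee_fin.
  - by move=> x _ m n mn; rewrite lee_wpmul2r ?lee_fin ?Y0 //; exact: h_nd.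
congr (limn _); apply/funext => n.
(* It remains to treat the simple function [h n], one value [r] at a time. *)
transitivity (\int[nu]_y (\sum_(r \in range (h n))
    (r * \1_(h n @^-1` [set r]) y)%:E)); last first.
  by apply: eq_integral => y _; rewrite fimfunE -fsumEFin.
rewrite ge0_integral_fsum //; last 2 first.
- by move=> r; apply/measurable_EFinP; apply: measurable_funM.
- by move=> r y _; exact: nnfun_muleindic_ge0.
transitivity (\int[mu]_(x in D) (\sum_(r \in range (h n))
    (r * \1_(h n @^-1` [set r]) (X x))%:E * (Y x)%:E)).
  apply: eq_integral => x _.
  rewrite -ge0_mule_fsuml => [|r]; last exact: nnfun_muleindic_ge0.
  by rewrite fsumEFin // -fimfunE.
have mr r : measurable_fun D
    (fun x => (r * \1_(h n @^-1` [set r]) (X x))%:E).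
  apply/measurable_EFinP/measurable_funTS; apply: measurable_funM => //.
  exact: measurableT_comp.
rewrite ge0_integral_fsum //; last 2 first.
- by move=> r; exact: emeasurable_funM.
- by move=> r x _; rewrite mule_ge0 ?lee_fin // -lee_fin nnfun_muleindic_ge0.
apply: eq_fsbigr => r; rewrite inE => -[y0 _ y0r].
have r0 : (0 <= r)%R by rewrite -y0r.
have mA : measurable (h n @^-1` [set r]) by [].
under [RHS]eq_integral do rewrite EFinM.
rewrite ge0_integralZl //; last first.
  by apply: measurableT_comp.
rewrite integral_indic // setIT -nuE //.
under eq_integral do rewrite EFinM -muleA.
rewrite ge0_integralZl //; last 2 first.
- apply: emeasurable_funM => //; apply/measurable_EFinP/measurable_funTS.
  exact: measurableT_comp.
- by move=> x _; rewrite mule_ge0 ?lee_fin.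
congr (_ * _); rewrite integral_mkcondr epatch_indic.
by apply: eq_integral => x _; rewrite muleC.
Qed.

End density.

(** * Moments of the exponential law *)

Section exponential_moments.
Variable R : realType.

(** The term of degree [n.+1] of the exponential series alone makes [expR x]
    outgrow [x ^+ n]. *)
Lemma cvg_exprn_expRN (n : nat) : (x : R) ^+ n * expR (- x) @[x --> +oo] --> 0.
Proof.
apply/cvgrPdist_lt => /= e e0; near=> x.
have x0 : 0 < x by near: x; apply: nbhs_pinfty_gt; exact: num_real.
rewrite sub0r normrN ger0_norm ?mulr_ge0 ?exprn_ge0 ?expR_ge0 ?ltW //.
rewrite expRN ltr_pdivrMr ?expR_gt0 // mulrC -ltr_pdivrMr //.
have ex : x ^+ n / e <= x ^+ n.+1 / n.+1`!%:R.
  rewrite exprSr -mulrA ler_wpM2l ?exprn_ge0 ?(ltW x0) //.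
  by rewrite ler_pdivlMr ?ltr0n ?fact_gt0.
apply: (le_lt_trans ex); apply: lt_le_trans (expR_ge1Dxn n (ltW x0)).
by rewrite ltrDr.
Unshelve. all: by end_near. Qed.

Lemma cvg_horner_expRN (p : {poly R}) : p.[x] * expR (- x) @[x --> +oo] --> 0.
Proof.
have -> : (fun x => p.[x] * expR (- x)) =
    (fun x => \sum_(i < size p) p`_i * (x ^+ i * expR (- x))).
  apply/funext => x; rewrite horner_coef mulr_suml.
  by apply: eq_bigr => i _; rewrite mulrA.
rewrite -[X in _ --> X](@big1_eq R 0 +%R 'I_(size p) (index_enum _) xpredT).
apply: (@cvg_big R _ _ _ _ (@add_continuous R)) => i _.
rewrite -[X in _ --> X](mulr0 p`_i).
by apply: cvgM; [exact: cvg_cst|exact: cvg_exprn_expRN].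
Qed.

(** Repeated integration by parts gives [- (gamma_poly j).[x] * expR (- x)] as
    an antiderivative of [x ^+ j * expR (- x)]. *)
Fixpoint gamma_poly (j : nat) : {poly R} :=
  if j is i.+1 then 'X^j + j%:R *: gamma_poly i else 1.

Lemma gamma_polyB_deriv j : gamma_poly j - (gamma_poly j)^`() = 'X^j.
Proof.
elim: j => [|j IHj] /=; first by rewrite derivC subr0 expr0.
rewrite derivD derivXn derivZ -(scaler_nat j.+1 'X^j) -IHj scalerBr.
by rewrite subrK addrK.
Qed.

Lemma horner0_gamma_poly j : (gamma_poly j).[0] = j`!%:R.
Proof.
elim: j => [|j IHj] /=; first by rewrite hornerC.
by rewrite hornerD hornerXn expr0n add0r hornerZ IHj factS natrM.
Qed.

Lemma integral0y_exprn_expRN (j : nat) :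
  (\int[lebesgue_measure]_(x in `[0%R, +oo[) (x ^+ j * expR (- x))%:E
   = (j`!%:R : R)%:E)%E.
Proof.
pose F (x : R) := - ((gamma_poly j).[x] * expR (- x)).
have dF (x : R) : is_derive x (1:R) F (x ^+ j * expR (- x)).
  apply: is_derive_eq.
  (* For [p := gamma_poly j] the derivative is [(p - p^`()).[x] * expR (- x)]. *)
  rewrite -[x ^+ j]hornerXn -gamma_polyB_deriv hornerD hornerN.
  rewrite /GRing.scale /=; ring.
rewrite (@ge0_continuous_FTC2y _ _ F _ 0).
- by rewrite /F oppr0 expR0 mulr1 horner0_gamma_poly sub0e EFinN oppeK.
- by move=> x x0; rewrite mulr_ge0 ?exprn_ge0 ?expR_ge0.
- apply: continuous_subspaceT => x.
  apply: cvgM; first exact: exprn_continuous.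
  apply: continuous_comp; last exact: continuous_expR.
  exact: opp_continuous.
- by rewrite -oppr0; apply: cvgN; exact: cvg_horner_expRN.
- by move=> x _; exact: ex_derive.
- apply: cvg_at_right_filter; apply: differentiable_continuous.
  by apply/derivable1_diffP; exact: ex_derive.
- by move=> x _; rewrite derive1E; exact: derive_val.
Qed.

Context d (T : measurableType d) (P : probability T R) (X : {RV P >-> R}).
Hypothesis X_exp : exponentially_distributed 1 X.

Lemma ge0_integral_exponential (f : R -> \bar R) :
  measurable_fun setT f -> (forall y, 0 <= f y)%E ->
  (\int[distribution P X]_x f x =
   \int[lebesgue_measure]_(x in `[0%R, +oo[) (f x * (expR (- x))%:E))%E.
Proof.
move=> mf f0.
rewrite -(@ge0_integral_density _ _ (measurableTypeR R) R R lebesgue_measure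
  (distribution P X) setT id (exponential_pdf 1)) //.
- rewrite [RHS]integral_mkcond; apply: eq_integral => x _ /=.
  rewrite patchE; case: ifPn => [|xN].
    rewrite inE /= in_itv /= andbT => x0.
    by rewrite exponential_pdfE // mul1r mulN1r.
  rewrite lt0_exponential_pdf ?mule0 //.
  by move: xN; rewrite notin_setE /= in_itv /= andbT => /negP; rewrite -ltNge.
- exact: measurable_exponential_pdf.
- by move=> x; exact: exponential_pdf_ge0.
- by move=> A mA; rewrite setTI; exact/esym/X_exp.
Qed.

Lemma exponential_moment (j : nat) :
  (\int[distribution P X]_x (`|x| ^+ j)%:E = j`!%:R%:E)%E.
Proof.
rewrite ge0_integral_exponential; last 2 first.
- by apply/measurable_EFinP; apply: measurable_funX; exact: normr_measurable.
- by move=> x; rewrite lee_fin exprn_ge0.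
rewrite -integral0y_exprn_expRN; apply: eq_integral => x.
by rewrite inE /= in_itv /= andbT => x0; rewrite ger0_norm // -EFinM.
Qed.

Lemma exponential_ae_ge0 : \forall w \ae P, 0 <= X w.
Proof.
exists (X @^-1` `]-oo, 0[); split.
- by rewrite -[X in measurable X]setTI; exact: measurable_funP.
- apply: etrans (X_exp (measurable_itv `]-oo, 0[)) _.
  apply: integral0_eq => x /=; rewrite in_itv /= => x0.
  by rewrite lt0_exponential_pdf.
- by move=> w /= /negP; rewrite -ltNge in_itv.
Qed.

End exponential_moments.

(** * Moments of weighted sums of independent exponential variables *)

Section moments.
Context d (T : measurableType d) (R : realType) (P : probability T R).
Variables (S : nat -> {RV P >-> R}) (a : nat -> R).
Hypotheses (S_iid : iid_unit_exponential S) (a_ge0 : forall k, 0 <= a k).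

Let cylinder (J : {fset nat}) (B : nat -> set R) : set T :=
  \bigcap_(i in [set` J]) (S i @^-1` B i).

Let measurable_cylinder J B : (forall i, i \in J -> measurable (B i)) ->
  measurable (cylinder J B).
Proof.
move=> mB; apply: bigcap_measurableType => i iJ.
by apply: measurable_funPTI; exact: mB.
Qed.

Let constrain (B : nat -> set R) k A i := if i == k then A else B i.

Let cylinderU1 J B k A : k \notin J ->
  cylinder (k |` J)%fset (constrain B k A) = cylinder J B `&` S k @^-1` A.
Proof.
move=> kJ; apply/seteqP; split=> [w Cw|w [Cw Aw] i /=].
  split=> [i iJ|].
    have := Cw i; rewrite /constrain; case: eqVneq => [ik|_]; last first.
      by apply; rewrite /= !inE; apply/orP; right.
    by move: kJ; rewrite -ik; move/negP.
  by have := Cw k; rewrite /constrain eqxx; apply; rewrite /= !inE eqxx.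
rewrite !inE /constrain; case: eqVneq => [->|_] //= iJ; exact: Cw.
Qed.

Let probability_cylinderU1 J B k A : k \notin J -> (0 < k)%N ->
  (forall i, i \in J -> (0 < i)%N) -> (forall i, i \in J -> measurable (B i)) ->
  measurable A ->
  P (cylinder J B `&` S k @^-1` A) =
  (P (cylinder J B) * distribution P (S k) A)%E.
Proof.
move=> kJ k0 J0 mB mA; have [ind _] := S_iid.
rewrite -cylinderU1 // /cylinder !ind //; last 2 first.
- by move=> i /=; rewrite !inE => /orP[/eqP->|/J0].
- by move=> i; rewrite !inE /constrain; case: eqP => //= _; exact: mB.
rewrite big_fsetU1 //= muleC; congr (_ * _)%E; last by rewrite /constrain eqxx.
rewrite !big_seq; apply: eq_bigr => i iJ; rewrite /constrain.
by case: eqP => // ik; move: kJ; rewrite -ik iJ.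
Qed.

Let absolute_sum n (w : T) := \sum_(1 <= k < n.+1) a k * `|S k w|.

Let absolute_sum_ge0 n w : 0 <= absolute_sum n w.
Proof. by apply: sumr_ge0 => k _; rewrite mulr_ge0. Qed.

Let measurable_absolute_sum n : measurable_fun setT (absolute_sum n).
Proof.
apply: measurable_sum => k; apply: measurable_funM => //.
exact: measurableT_comp.
Qed.

(** The power of the sum of the first [n] variables is uncorrelated with every
    event that only constrains variables of larger index.  Carrying the event
    along is what lets the induction on [n] use independence: constraining
    [S n.+1] to lie in [A] gives again a cylinder, to which the hypothesis for
    [n] applies. *)
Lemma absolute_moment_cylinder n m J B :
  (forall i, i \in J -> (n < i)%N) -> (forall i, i \in J -> measurable (B i)) ->
  (\int[P]_(w in cylinder J B) (absolute_sum n w ^+ m)%:E =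
   (m`!%:R * complete_homogeneous a n m)%:E * P (cylinder J B))%E.
Proof.
elim: n m J B => [|n IHn] m J B nJ mB.
  have -> : (fun w => (absolute_sum 0 w ^+ m)%:E) = cst ((m == 0%N)%:R)%:E.
    apply/funext => w; rewrite /absolute_sum big_nil /=.
    by case: m => [|m]; rewrite ?expr0 ?expr0n.
  rewrite integral_cst; last exact: measurable_cylinder.
  case: m => [|m] /=; first by rewrite complete_homogeneous0r mulr1.
  by rewrite /complete_homogeneous /= big_nil mulr0.
have mG := measurable_cylinder mB; set G := cylinder J B in mG *.
pose X := S n.+1; pose p := fine (P G).
have PG : P G = p%:E by rewrite fineK ?fin_num_measure.
have nJ' : n.+1 \notin J by apply/negP => /nJ; rewrite ltnn.
(* The constant of proportionality between the law of [X] and the measure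
   [A |-> \int[P]_(w in G `&` X @^-1` A) (absolute_sum n w ^+ j)%:E]. *)
pose c j := j`!%:R * complete_homogeneous a n j * p.
have c0 j : 0 <= c j.
  by rewrite !mulr_ge0 ?complete_homogeneous_ge0 ?fine_ge0.
have term i j :
    (\int[P]_(w in G) ((`|X w| ^+ i)%:E * (absolute_sum n w ^+ j)%:E) =
     (c j * i`!%:R)%:E)%E.
  pose f (x : R) := (`|x| ^+ i)%:E.
  have mf : measurable_fun setT f.
    by apply/measurable_EFinP; apply: measurable_funX; exact: normr_measurable.
  have f0 x : (0 <= f x)%E by rewrite lee_fin exprn_ge0.
  apply: etrans (ge0_integral_density (D := G) (X := X)
    (nu := mscale (NngNum (c0 j)) (distribution P X)) mG _ _ _ _ mf f0) _.
  - exact: measurable_funP.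
  - by apply: measurable_funX; exact: measurable_absolute_sum.
  - by move=> w; rewrite exprn_ge0.
  - move=> A mA; rewrite -cylinderU1 // IHn; last 2 first.
    + by move=> k; rewrite !inE => /orP[/eqP->//|/nJ/ltnW].
    + by move=> k; rewrite !inE /constrain; case: eqP => //= _; exact: mB.
    rewrite cylinderU1 // probability_cylinderU1 //; last first.
      by move=> k /nJ; exact: leq_trans.
    by rewrite -/G PG muleA -EFinM.
  - rewrite ge0_integral_mscale //= exponential_moment ?EFinM //.
    by have [_] := S_iid; apply.
(* Binomial expansion of the power of [absolute_sum n w + a n.+1 * `|X w|]. *)
transitivity (\int[P]_(w in G) \sum_(i < m.+1) (('C(m, i)%:R * a n.+1 ^+ i)%:E *
    ((`|X w| ^+ i)%:E * (absolute_sum n w ^+ (m - i))%:E)))%E.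
  apply: eq_integral => w _.
  rewrite /absolute_sum big_nat_recr //= exprDn -sumEFin.
  apply: eq_bigr => i _; rewrite -!EFinM; congr (_%:E).
  by rewrite exprMn -mulr_natl; ring.
have mterm i j : measurable_fun G
    (fun w => (`|X w| ^+ i)%:E * (absolute_sum n w ^+ j)%:E)%E.
  apply: emeasurable_funM; apply/measurable_EFinP/measurable_funTS.
    by apply: measurable_funX; exact: measurableT_comp.
  by apply: measurable_funX; exact: measurable_absolute_sum.
rewrite ge0_integral_sum //; last 2 first.
- by move=> i; apply: emeasurable_funM => //; exact: measurable_cst.
- by move=> i w _; rewrite !mule_ge0 ?lee_fin ?mulr_ge0 ?exprn_ge0.
transitivity (\sum_(i < m.+1)
    (('C(m, i)%:R * a n.+1 ^+ i) * (c (m - i)%N * i`!%:R))%:E)%E.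
  apply: eq_bigr => i _; rewrite ge0_integralZl_EFin ?term //.
  - by move=> w _; rewrite mule_ge0 ?lee_fin ?exprn_ge0.
  - by rewrite mulr_ge0 ?exprn_ge0.
rewrite sumEFin PG -EFinM complete_homogeneousS mulr_sumr mulr_suml.
congr (_%:E); apply: eq_bigr => i _.
rewrite -(bin_fact (leq_ord i)) /c !natrM; ring.
Qed.

Let expectation_absolute_sum n m :
  (\int[P]_w (absolute_sum n w ^+ m)%:E =
   (m`!%:R * complete_homogeneous a n m)%:E)%E.
Proof.
have -> : [set: T] = cylinder fset0 (fun=> setT) by apply/seteqP; split.
rewrite absolute_moment_cylinder //.
have -> : cylinder fset0 (fun=> setT) = [set: T] by apply/seteqP; split.
by rewrite probability_setT mule1.
Qed.

(** Almost surely [S k] equals its absolute value for all [k > 0], and the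
    moment of the absolute sum is finite, so the constant [t ^+ m], of any sign,
    may be taken out of the integral. *)
Lemma exponential_sum_moment (t : R) n m :
  (\int[P]_w ((t * \sum_(1 <= k < n.+1) a k * S k w) ^+ m)%:E =
   (t ^+ m * m`!%:R * complete_homogeneous a n m)%:E)%E.
Proof.
have mA : measurable_fun setT (fun w => (absolute_sum n w ^+ m)%:E).
  by apply/measurable_EFinP/measurable_funX/measurable_absolute_sum.
have iA : P.-integrable setT (fun w => (absolute_sum n w ^+ m)%:E).
  apply/integrableP; split => //.
  under eq_integral do rewrite gee0_abs ?lee_fin ?exprn_ge0 //.
  by rewrite expectation_absolute_sum ltry.
rewrite -mulrA EFinM -expectation_absolute_sum -integralZl //.
apply: ae_eq_integral => //.
- apply/measurable_EFinP/measurable_funX/measurable_funM => //.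
  by apply: measurable_sum => k; exact: measurable_funM.
- exact: measurable_funeM.
have S_ge0 : \forall w \ae P, forall k, (0 < k)%N -> 0 <= S k w.
  apply/ae_foralln => k; have [->|k0] := posnP k; first exact: aeW.
  by apply: filterS (exponential_ae_ge0 (S_iid.2 _ k0)) => w.
apply: filterS S_ge0 => w Sw _ /=; rewrite -EFinM -exprMn.
congr ((_ * _) ^+ _)%:E; rewrite /absolute_sum !big_nat.
by apply: eq_bigr => k /andP[k0 _]; rewrite ger0_norm ?Sw.
Qed.

End moments.

(** * The moments of the geometrically weighted sum *)

Theorem theorem6p1 (d : measure_display) (T : measurableType d) (R : realType)
    (P : probability T R) (S : nat -> {RV P >-> R}) (zeta theta : R)
    (hS : iid_unit_exponential S) (hzeta : 0 < zeta < 1) (n m : nat)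
    (hm : (0 < m)%N) :
  ('E_P[(fun w => weighted_sum theta zeta S n w ^+ m)%R] =
   (theta ^+ m * m`!%:R *
    \sum_(m <= k < (n * m).+1) (num_partitions n k m)%:R * zeta ^+ k)%:E)%E.
Proof.
have zeta_ge0 k : 0 <= zeta ^+ k.
  by case/andP: hzeta => /ltW z0 _; exact: exprn_ge0.
rewrite unlock -complete_homogeneous_expr.
exact: (exponential_sum_moment hS zeta_ge0).
Qed.
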